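(* There exists a constant $\mathfrak c>1$, not depending on $\varepsilon$, $d$ and $T$, such that the following holds. Let $T=p\tau$ with $p,\tau\geqslant1$ integers, and let $\mathbf\Lambda=(\mathbf I_\tau|\dots|\mathbf I_\tau)\in\mathcal M_{\tau,T}(\mathbb R)$ be the concatenation of $p$ copies of the identity matrix $\mathbf I_\tau$. Let $\mathbf X=\mathbf M+\varepsilon$ with $\mathbf M=\mathbf U\mathbf V\mathbf\Lambda$, where $\mathbf U\in\mathcal M_{d,k}(\mathbb R)$ and $\mathbf V\in\mathcal M_{k,\tau}(\mathbb R)$ are deterministic. Assume that $\varepsilon$ satisfies the noise assumption given in the context and that $\widetilde\varepsilon:=\varepsilon\mathbf\Lambda^+$ satisfies $\mathfrak K_{\widetilde\varepsilon}\leqslant\mathfrak K_\varepsilon$. Let $\mathcal S\subseteq\mathcal M_{d,\tau}(\mathbb R)$ be a non-empty set of matrices of rank at most $k$, let $$\widehat{\widetilde{\mathbf M}}_{\mathcal S}\in\arg\min_{\mathbf A\in\mathcal S}\|\mathbf A-\mathbf X\mathbf\Lambda^+\|_F^2,\qquad \widehat{\mathbf M}_{\mathcal S}:=\widehat{\widetilde{\mathbf M}}_{\mathcal S}\,\mathbf\Lambda .$$ Then for every $\lambda\in(0,1)$ and $s\in[0,\infty)$, $$\frac{1}{dT}\left\|\widehat{\mathbf M}_{\mathcal S}-\mathbf M\right\|_F^2\leqslant\frac{1+\lambda}{1-\lambda}\cdot\min_{\mathbf A\in\mathcal S}\frac1{dT}\left\|\mathbf A\mathbf\Lambda-\mathbf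 M\right\|_F^2+\frac{4\mathfrak c\,\widetilde{\mathfrak K}_\varepsilon\|\Sigma_\varepsilon\|_{\mathrm{op}}}{\lambda(1-\lambda)}\cdot\frac{k(d+\tau+s)}{dT}$$ with probability larger than $1-2e^{-s}$.
   Context: $d\geqslant1$, $T\geqslant2$ and $k\in\{1,\dots,T\}$ are integers. $\mathcal M_{m,n}(\mathbb R)$ is the set of real $m\times n$ matrices. $\|\mathbf A\|_F=\mathrm{trace}(\mathbf A\mathbf A^* )^{1/2}$ and $\|\mathbf A\|_{\mathrm{op}}=\sup_{\|x\|=1}\|\mathbf Ax\|$ (Euclidean norms). $\mathbf\Lambda^+:=\mathbf\Lambda^*(\mathbf\Lambda\mathbf\Lambda^* )^{-1}$ is the pseudo-inverse of $\mathbf\Lambda$. The form $\mathbf M=\mathbf U\mathbf V\mathbf\Lambda$ expresses that the latent series (rows of $\mathbf V\mathbf\Lambda$) are $\tau$-periodic. Noise assumption: $\varepsilon$ is a random $d\times T$ real matrix whose rows are independent and have the same $T$-dimensional sub-Gaussian distribution, with second moment matrix $\Sigma_\varepsilon=\mathbb E(\varepsilon_{1,\cdot}^*\varepsilon_{1,\cdot})$ (invertible), where $\varepsilon_{1,\cdot}$ is the first row. Moreover $\varepsilon_{1,\cdot}\Sigma_\varepsilon^{-1/2}$ is isotropic and has finite sub-Gaussian norm $$\mathfrak K_\varepsilon:=\sup_{\|x\|=1}\ \sup_{p\in[1,\infty)}p^{-1/2}\,\mathbb E\big(|\langle\varepsilon_{1,\cdot}\Sigma_\varepsilon^{-1/2},x\rangle|^p\big)^{1/p}<\infty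 .$$ Set $\widetilde{\mathfrak K}_\varepsilon:=\max(\mathfrak K_\varepsilon^2,\mathfrak K_\varepsilon^4)$. The quantity $\mathfrak K_{\widetilde\varepsilon}$ is defined by the same formula with $\varepsilon$ replaced by $\widetilde\varepsilon$ and $\Sigma_\varepsilon$ replaced by $\Sigma_{\widetilde\varepsilon}=\mathbb E(\widetilde\varepsilon_{1,\cdot}^*\widetilde\varepsilon_{1,\cdot})$, the supremum being over unit vectors of $\mathbb R^\tau$. The argmin defining the estimator is assumed non-empty; the minimum over $\mathcal S$ on the right-hand side is read as an infimum if it is not attained. *)

(* Defs.v *)
From HB Require Import structures.
From mathcomp Require Import all_boot all_order all_algebra.
From mathcomp Require Import all_classical all_reals all_analysis.
Set Implicit Arguments.
Unset Strict Implicit.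
Unset Printing Implicit Defensive.
Import Order.TTheory GRing.Theory Num.Theory.
Import numFieldNormedType.Exports.
Local Open Scope classical_set_scope.
Local Open Scope ring_scope.

Section matrices.
Context {R : realType}.

Definition enorm n (x : 'cV[R]_n) : R := Num.sqrt (\sum_i x i 0 ^+ 2).

Definition frobenius m n (A : 'M[R]_(m, n)) : R := Num.sqrt (\tr (A *m A^T)).

Definition opnorm m n (A : 'M[R]_(m, n)) : R :=
  sup [set enorm (A *m x) | x in [set x : 'cV[R]_n | enorm x = 1]].

(* A^+ = A^T (A A^T)^-1, the pseudo-inverse of a matrix of full row rank. *)
Definition pseudo_inverse m n (A : 'M[R]_(m, n)) : 'M[R]_(n, m) :=
  A^T *m invmx (A *m A^T).

(* The concatenation (I | ... | I) of identity matrices of size tau: with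
   indices starting at 0, column j carries its 1 in row j mod tau. *)
Definition periodic_mx tau T : 'M[R]_(tau, T) :=
  \matrix_(i, j) ((j %% tau)%N == i :> nat)%:R.

Definition posdefmx n (A : 'M[R]_n) : Prop :=
  A^T = A /\ forall x : 'cV[R]_n, x != 0 -> 0 < (x^T *m A *m x) 0 0.

(* S^(-1/2), the symmetric positive definite square root of S^-1; it exists
   and is unique when S is symmetric positive definite; the default value 0
   is returned when there is no such root. *)
Definition inv_sqrtmx n (S : 'M[R]_n) : 'M[R]_n :=
  xget 0 [set B | posdefmx B /\ B *m B = invmx S].

Definition argmin (T : Type) (D : set T) (f : T -> R) : set T :=
  [set a | D a /\ forall b, D b -> f a <= f b].

End matrices.

Section probability.
Context {R : realType} {disp : measure_display} {Omega : measurableType disp}.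
Variable P : probability Omega R.

Definition mutually_independent (I : finType) {d'} {E : measurableType d'}
    (X : I -> Omega -> E) : Prop :=
  forall (J : {set I}) (B : I -> set E), (forall i, measurable (B i)) ->
    P (\bigcap_(i in [set` J]) (X i @^-1` B i)) =
    (\prod_(i in J) P (X i @^-1` B i))%E.

Definition same_distribution {d'} {E : measurableType d'}
    (X Y : Omega -> E) : Prop :=
  forall B : set E, measurable B -> P (X @^-1` B) = P (Y @^-1` B).

(* sup over real p >= 1 of p^(-1/2) E(|Z|^p)^(1/p). *)
Definition subgaussian_norm1 (Z : Omega -> R) : \bar R :=
  ereal_sup [set ((p `^ (- 2^-1))%:E * 'N[P]_(p%:E) [EFin \o Z])%E
            | p in [set p : R | 1 <= p]].

Definition marginal n (xi : Omega -> 'rV[R]_n) (x : 'cV[R]_n) : Omega -> R :=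
  fun w => (xi w *m x) 0 0.

Definition subgaussian_norm n (xi : Omega -> 'rV[R]_n) : \bar R :=
  ereal_sup [set subgaussian_norm1 (marginal xi x)
            | x in [set x : 'cV[R]_n | enorm x = 1]].

(* A random vector is sub-Gaussian when all its one-dimensional marginals are. *)
Definition subgaussian n (xi : Omega -> 'rV[R]_n) : Prop :=
  forall x : 'cV[R]_n, (subgaussian_norm1 (marginal xi x) < +oo)%E.

(* E(xi^T xi), not centred; only used for xi with finite second moments. *)
Definition second_moment n (xi : Omega -> 'rV[R]_n) : 'M[R]_n :=
  \matrix_(a, b) fine ('E_P[fun w => xi w 0 a * xi w 0 b]).

Definition isotropic n (xi : Omega -> 'rV[R]_n) : Prop :=
  second_moment xi = 1%:M.

Definition whiten n (xi : Omega -> 'rV[R]_n) : Omega -> 'rV[R]_n :=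
  fun w => xi w *m inv_sqrtmx (second_moment xi).

(* Rows as random elements of the measurable space of tuples, which carries
   the product sigma-algebra on R^T. *)
Definition row_tuple d T (eps : Omega -> 'M[R]_(d, T)) (i : 'I_d) :
    Omega -> T.-tuple R :=
  fun w => [tuple eps w i j | j < T].

Definition first_row d T (d_gt0 : (0 < d)%N) (eps : Omega -> 'M[R]_(d, T)) :
    Omega -> 'rV[R]_T :=
  fun w => row (Ordinal d_gt0) (eps w).

Definition Sigma d T (d_gt0 : (0 < d)%N) (eps : Omega -> 'M[R]_(d, T)) :
    'M[R]_T :=
  second_moment (first_row d_gt0 eps).

(* The constant K_eps, possibly infinite. *)
Definition Knorm d T (d_gt0 : (0 < d)%N) (eps : Omega -> 'M[R]_(d, T)) :
    \bar R :=
  subgaussian_norm (whiten (first_row d_gt0 eps)).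

Definition Ktilde d T (d_gt0 : (0 < d)%N) (eps : Omega -> 'M[R]_(d, T)) : R :=
  Num.max (fine (Knorm d_gt0 eps) ^+ 2) (fine (Knorm d_gt0 eps) ^+ 4).

Record noise_assumption d T (d_gt0 : (0 < d)%N)
    (eps : Omega -> 'M[R]_(d, T)) : Prop := {
  noise_measurable :
    forall i j, measurable_fun [set: Omega] (fun w => eps w i j);
  noise_independent : mutually_independent (row_tuple eps);
  noise_identical :
    forall i j, same_distribution (row_tuple eps i) (row_tuple eps j);
  noise_subgaussian : subgaussian (first_row d_gt0 eps);
  noise_invertible : Sigma d_gt0 eps \in unitmx;
  noise_isotropic : isotropic (whiten (first_row d_gt0 eps));
  noise_Knorm : (Knorm d_gt0 eps < +oo)%E
}.

End probability.

(* Main.v *)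
Require Import Defs.
From mathcomp Require Import all_boot all_order all_algebra.
From mathcomp Require Import all_classical all_reals all_analysis.
From mathcomp Require Import measurable_realfun ring lra.
Import Order.TTheory GRing.Theory Num.Theory.
Import numFieldNormedType.Exports.
Local Open Scope classical_set_scope.
Local Open Scope ring_scope.

Set Implicit Arguments.
Unset Strict Implicit.
Unset Printing Implicit Defensive.

(* Since Lambda Lambda^T = p I, the problem reduces to least squares for
   N = U V from N + epst with epst = eps Lambda^+.  Optimality of the estimator
   gives |Mh - N|^2 <= |A - N|^2 + 2 <epst, Mh - A>, and as Mh - A has rank at
   most 2k the inner product is at most sqrt (2k) |epst|_op |Mh - A|; AM-GM
   concludes once p |epst|_op^2 = O(K^2 |Sigma|_op (d + tau + s)).

   For a fixed y, |epst y|^2 is a sum of d independent squares of sub-Gaussian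
   variables <eps_i, Lambda^+ y>, whose exponential moments are bounded through
   the moments; only K_eps intervenes, and no centering is needed.  The supremum
   over the unit sphere is reduced to a maximum over at most 64^tau points of
   the lattice tau^(-1/2) Z^tau: rounding each coordinate of y in the direction
   of the sign of epst^T u cannot decrease <u, epst y>. *)

(** * Squared Frobenius norms, projections and the deterministic oracle inequality *)

Section SquaredNorm.
Context {R : realType}.

Definition sqnorm m n (A : 'M[R]_(m, n)) : R := \tr (A *m A^T).

Lemma sqnormE m n (A : 'M[R]_(m, n)) : sqnorm A = \sum_i \sum_j A i j ^+ 2.
Proof.
by apply: eq_bigr => i _; rewrite mxE; apply: eq_bigr => j _; rewrite mxE expr2.
Qed.

Lemma sqnorm_ge0 m n (A : 'M[R]_(m, n)) : 0 <= sqnorm A.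
Proof.
by rewrite sqnormE; apply: sumr_ge0 => i _; apply: sumr_ge0 => j _; exact: sqr_ge0.
Qed.

Lemma sqnorm_cV n (x : 'cV[R]_n) : sqnorm x = \sum_i x i 0 ^+ 2.
Proof. by rewrite sqnormE; apply: eq_bigr => i _; rewrite big_ord1. Qed.

Lemma sqnormT m n (A : 'M[R]_(m, n)) : sqnorm A^T = sqnorm A.
Proof. by rewrite /sqnorm trmxK mxtrace_mulC. Qed.

Lemma sqnorm0 m n : sqnorm (0 : 'M[R]_(m, n)) = 0.
Proof. by rewrite /sqnorm mul0mx mxtrace0. Qed.

Lemma sqnorm_eq0 m n (A : 'M[R]_(m, n)) : (sqnorm A == 0) = (A == 0).
Proof.
apply/eqP/eqP => [|->]; last exact: sqnorm0.
rewrite sqnormE => A0; apply/matrixP => i j; rewrite mxE.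
have s0 i' : 0 <= \sum_j' A i' j' ^+ 2 by apply: sumr_ge0 => ? _; exact: sqr_ge0.
have Ai := psumr_eq0P (fun i' _ => s0 i') A0.
have Aij := psumr_eq0P (fun j' _ => sqr_ge0 (A i j')) (Ai i isT).
by have /eqP := Aij j isT; rewrite sqrf_eq0 => /eqP.
Qed.

Lemma trmx_scale m n a (A : 'M[R]_(m, n)) : (a *: A)^T = a *: A^T.
Proof. exact: linearZ. Qed.

Lemma sqnormZ m n a (A : 'M[R]_(m, n)) : sqnorm (a *: A) = a ^+ 2 * sqnorm A.
Proof.
by rewrite /sqnorm trmx_scale -scalemxAl -scalemxAr !mxtraceZ mulrA expr2.
Qed.

Lemma mxtrace_mulmxTC m n (A B : 'M[R]_(m, n)) : \tr (A *m B^T) = \tr (B *m A^T).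
Proof. by rewrite -mxtrace_tr trmx_mul trmxK. Qed.

Lemma sqnormD m n (A B : 'M[R]_(m, n)) :
  sqnorm (A + B) = sqnorm A + 2 * \tr (A *m B^T) + sqnorm B.
Proof.
rewrite /sqnorm linearD/= mulmxDl !mulmxDr !mxtraceD (mxtrace_mulmxTC B A).
by ring.
Qed.

Lemma sqnormB m n (A B : 'M[R]_(m, n)) :
  sqnorm (A - B) = sqnorm A - 2 * \tr (A *m B^T) + sqnorm B.
Proof.
rewrite sqnormD linearN/= mulmxN raddfN/= mulrN; congr (_ + _).
by rewrite -[sqnorm B]mul1r -scaleN1r sqnormZ sqrrN expr1n.
Qed.

(** Expanding |b A - c B|^2 >= 0 with b = |B|^2 and c = <A, B> gives b (|A|^2 b - c^2) >= 0. *)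
Lemma mxtrace_CauchySchwarz m n (A B : 'M[R]_(m, n)) :
  \tr (A *m B^T) ^+ 2 <= sqnorm A * sqnorm B.
Proof.
have [->|B0] := eqVneq B 0.
  by rewrite trmx0 mulmx0 mxtrace0 sqnorm0 mulr0 expr0n.
have b0 : 0 < sqnorm B by rewrite lt_def sqnorm_eq0 B0 sqnorm_ge0.
have := sqnorm_ge0 (sqnorm B *: A - \tr (A *m B^T) *: B).
rewrite sqnormB !sqnormZ trmx_scale -scalemxAl -scalemxAr !mxtraceZ.
set a := sqnorm A; set b := sqnorm B in b0 *; set c := \tr _.
rewrite (_ : _ + _ = b * (a * b - c ^+ 2)); last by ring.
by rewrite pmulr_rge0// subr_ge0.
Qed.

Lemma sqnorm_mul_col m n q (A : 'M[R]_(m, n)) (B : 'M[R]_(n, q)) :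
  sqnorm (A *m B) = \sum_j sqnorm (A *m col j B).
Proof.
rewrite sqnormE exchange_big/=; apply: eq_bigr => j _; rewrite sqnorm_cV.
by apply: eq_bigr => i _; rewrite colE mulmxA -colE [in RHS]mxE.
Qed.

Lemma sqnorm_mulmx_cV m n (A : 'M[R]_(m, n)) (x : 'cV[R]_n) :
  sqnorm (A *m x) <= sqnorm A * sqnorm x.
Proof.
rewrite sqnorm_cV sqnormE mulr_suml; apply: ler_sum => i _.
have -> : (A *m x) i 0 = \tr (row i A *m x^T^T).
  by rewrite trmxK /mxtrace big_ord1 !mxE; apply: eq_bigr => j _; rewrite mxE.
apply: (le_trans (mxtrace_CauchySchwarz _ _)); rewrite sqnormT.
by rewrite [sqnorm (row _ _)]sqnormE big_ord1; under eq_bigr do rewrite mxE.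
Qed.

Lemma frobenius_sqr m n (A : 'M[R]_(m, n)) : frobenius A ^+ 2 = sqnorm A.
Proof. by rewrite sqr_sqrtr// sqnorm_ge0. Qed.

Lemma enorm_sqr n (x : 'cV[R]_n) : enorm x ^+ 2 = sqnorm x.
Proof. by rewrite sqr_sqrtr -sqnorm_cV// sqnorm_ge0. Qed.

Lemma enormE n (x : 'cV[R]_n) : enorm x = Num.sqrt (sqnorm x).
Proof. by rewrite sqnorm_cV. Qed.

Lemma opnorm_ub n (S : 'M[R]_n) (x : 'cV[R]_n) : enorm x = 1 ->
  enorm (S *m x) <= opnorm S.
Proof.
move=> x1; apply: ub_le_sup; last by exists x.
(* [sup] is an upper bound only for a bounded set; the Frobenius norm of [S] bounds this one. *)
exists (Num.sqrt (sqnorm S)) => _ [y /= y1 <-].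
rewrite enormE ler_wsqrtr//; apply: (le_trans (sqnorm_mulmx_cV _ _)).
by rewrite -(enorm_sqr y) y1 expr1n mulr1.
Qed.

(** By homogeneity [x] may be replaced by a unit vector y, and y^T S y = <S y, y> is at most |S y|
    by Cauchy-Schwarz. *)
Lemma quadratic_form_le_opnorm n (S : 'M[R]_n) (x : 'cV[R]_n) :
  (x^T *m S *m x) 0 0 <= opnorm S * sqnorm x.
Proof.
have [->|x0] := eqVneq x 0; first by rewrite mulmx0 mxE sqnorm0 mulr0.
have sx : 0 < sqnorm x by rewrite lt_def sqnorm_eq0 x0 sqnorm_ge0.
set r := Num.sqrt (sqnorm x); have r0 : 0 < r by rewrite sqrtr_gt0.
pose y := r^-1 *: x.
have xE : x = r *: y by rewrite scalerA divff ?gt_eqF// scale1r.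
have sy : sqnorm y = 1.
  by rewrite sqnormZ exprVn sqr_sqrtr ?sqnorm_ge0// mulVf// gt_eqF.
have y1 : enorm y = 1 by rewrite enormE sy sqrtr1.
rewrite xE sqnormZ sy mulr1 trmx_scale -!scalemxAl -scalemxAr scalerA mxE mulrC.
rewrite -expr2 ler_wpM2r ?sqr_ge0//; apply: le_trans (opnorm_ub S y1).
rewrite enormE; apply: le_trans (ler_norm _) _; rewrite -sqrtr_sqr ler_wsqrtr//.
have -> : (y^T *m S *m y) 0 0 = \tr ((S *m y) *m y^T).
  by rewrite mxtrace_mulC mulmxA /mxtrace big_ord1.
by apply: le_trans (mxtrace_CauchySchwarz _ _) _; rewrite sy mulr1.
Qed.

(** If u Q Q^T = 0, then |u Q|^2 = 0, so u Q = 0, and u = 0 by freeness. *)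
Lemma gram_unit r n (Q : 'M[R]_(r, n)) : row_free Q -> Q *m Q^T \in unitmx.
Proof.
move=> Qfree; rewrite -row_free_unit -kermx_eq0.
apply/eqP/row_matrixP => i; rewrite row0; set u := row i _.
have uQQ : u *m Q *m Q^T = 0.
  by rewrite -mulmxA; apply/sub_kermxP; exact: row_sub.
have /eqP : sqnorm (u *m Q) = 0.
  by rewrite /sqnorm trmx_mul mulmxA uQQ mul0mx mxtrace0.
rewrite sqnorm_eq0 => /eqP uQ.
by apply: (row_free_inj Qfree); rewrite mul0mx.
Qed.

(** The witness is Q^T (Q Q^T)^-1 Q, the orthogonal projection onto the row space; its trace follows
    by cyclicity. *)
Lemma row_free_projection r n (Q : 'M[R]_(r, n)) : row_free Q ->
  exists Pi : 'M[R]_n,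
    [/\ Pi^T = Pi, Pi *m Pi = Pi, Q *m Pi = Q & \tr Pi = r%:R].
Proof.
move=> /gram_unit Qu.
have QQT : (invmx (Q *m Q^T))^T = invmx (Q *m Q^T).
  by rewrite trmx_inv trmx_mul trmxK.
have QPi : Q *m (Q^T *m invmx (Q *m Q^T) *m Q) = Q.
  by rewrite !mulmxA mulmxV// mul1mx.
exists (Q^T *m invmx (Q *m Q^T) *m Q); split => //.
- by rewrite !trmx_mul trmxK QQT mulmxA.
- by rewrite -mulmxA QPi.
- by rewrite mxtrace_mulC mulmxA mulmxV// mxtrace1.
Qed.

(** [B] factors through the free family [row_base B], whose projection therefore also fixes [B]. *)
Lemma row_space_projection m n (B : 'M[R]_(m, n)) : exists Pi : 'M[R]_n,
  [/\ Pi^T = Pi, Pi *m Pi = Pi, B *m Pi = B & \tr Pi = (\rank B)%:R].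
Proof.
have [Pi [PiT Pi2 QPi trPi]] := row_free_projection (row_base_free B).
exists Pi; split => //; have /submxP[D BE] : (B <= row_base B)%MS.
  by rewrite eq_row_base.
by rewrite BE -mulmxA QPi.
Qed.

(* The trace only sees E Pi, with Pi the orthogonal projection onto the row
   space of B, and |E Pi|^2 <= t |Pi|^2 = t rank B. *)
Lemma mxtrace_le_rank m n (E B : 'M[R]_(m, n)) t :
  (forall y : 'cV[R]_n, sqnorm (E *m y) <= t * sqnorm y) ->
  \tr (B *m E^T) ^+ 2 <= (\rank B)%:R * t * sqnorm B.
Proof.
move=> Et; have [Pi [PiT Pi2 BPi trPi]] := row_space_projection B.
have -> : \tr (B *m E^T) = \tr (B *m (E *m Pi)^T).
  by rewrite trmx_mul PiT mulmxA BPi.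
apply: (le_trans (mxtrace_CauchySchwarz _ _)); rewrite mulrC.
rewrite ler_wpM2r ?sqnorm_ge0// sqnorm_mul_col.
(* The factor [1%:M] lets [sqnorm_mul_col] reassemble the columns into [sqnorm Pi], which is the
   trace of the symmetric idempotent [Pi]. *)
apply: (@le_trans _ _ (\sum_j t * sqnorm (1%:M *m col j Pi))).
  by apply: ler_sum => j _; rewrite mul1mx.
by rewrite -mulr_sumr -sqnorm_mul_col mul1mx /sqnorm PiT Pi2 trPi mulrC.
Qed.

(** The deterministic half of the argument: [E] stands for the noise and [t] for a bound on its
    squared operator norm. *)
Lemma oracle_inequality m n k (N E Mh A : 'M[R]_(m, n)) t lambda :
  0 < lambda < 1 -> 0 <= t ->
  (forall y : 'cV[R]_n, sqnorm (E *m y) <= t * sqnorm y) ->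
  (\rank Mh <= k)%N -> (\rank A <= k)%N ->
  sqnorm (Mh - (N + E)) <= sqnorm (A - (N + E)) ->
  sqnorm (Mh - N) <= (1 + lambda) / (1 - lambda) * sqnorm (A - N) +
    4 / (lambda * (1 - lambda)) * (k%:R * t).
Proof.
move=> /andP[l0 l1] t0 Et rM rA; rewrite !opprD !addrA.
rewrite (sqnormB (Mh - N)) (sqnormB (A - N)).
set a := sqnorm (Mh - N); set b := sqnorm (A - N) => ab.
set B := Mh - A.
have BE : \tr (B *m E^T) = \tr ((Mh - N) *m E^T) - \tr ((A - N) *m E^T).
  by rewrite -raddfB/= -mulmxBl; congr (\tr (_ *m _)); rewrite opprB addrA subrK.
have rB : (\rank B)%:R <= 2 * k%:R :> R.
  rewrite -natrM ler_nat mul2n -addnn; apply: leq_trans (mxrank_add _ _) _.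
  by rewrite mxrank_opp leq_add.
(* Parallelogram identity: |x - y|^2 = 2 |x|^2 + 2 |y|^2 - |x + y|^2. *)
have BB : sqnorm B <= 2 * (a + b).
  have -> : B = (Mh - N) - (A - N) by rewrite opprB addrA subrK.
  have := sqnorm_ge0 ((Mh - N) + (A - N)).
  by rewrite sqnormB sqnormD -/a -/b; lra.
have T2 : \tr (B *m E^T) ^+ 2 <= 4 * k%:R * t * (a + b).
  apply: (le_trans (mxtrace_le_rank B Et)).
  apply: (@le_trans _ _ ((2 * k%:R) * t * (2 * (a + b)))); last by lra.
  apply: ler_pM => //; first by rewrite mulr_ge0.
    exact: sqnorm_ge0.
  by rewrite ler_wpM2r.
have a0 : 0 <= a := sqnorm_ge0 _. have b0 : 0 <= b := sqnorm_ge0 _.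
have kt0 : 0 <= k%:R * t by rewrite mulr_ge0.
(* AM-GM: 2 tr <= lambda (a + b) + 4 k t / lambda *)
have T1 : 2 * \tr (B *m E^T) <= lambda * (a + b) + 4 / lambda * (k%:R * t).
  have r0 : 0 <= lambda * (a + b) + 4 / lambda * (k%:R * t).
    by rewrite addr_ge0 ?mulr_ge0 ?addr_ge0 ?invr_ge0 ?(ltW l0).
  apply: le_trans (ler_norm _) _.
  rewrite -(@ler_pXn2r _ 2)// ?nnegrE// real_normK ?num_real//.
  rewrite exprMn; apply: (@le_trans _ _ (4 * (lambda * (a + b)) * (4 / lambda * (k%:R * t)))).
    rewrite (_ : 4 * _ * _ = 4 * (4 * k%:R * t * (a + b))); last first.
      by field; rewrite gt_eqF.
    by lra.
  have := sqr_ge0 (lambda * (a + b) - 4 / lambda * (k%:R * t)); lra.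
have l1' : 0 < 1 - lambda by rewrite subr_gt0.
(* Minimality and [T1] give (1 - lambda) a <= (1 + lambda) b + 4 k t / lambda. *)
rewrite -(@ler_pM2l _ (1 - lambda))// mulrDr.
have -> : (1 - lambda) * ((1 + lambda) / (1 - lambda) * b) = (1 + lambda) * b.
  by field; rewrite gt_eqF.
have -> : (1 - lambda) * (4 / (lambda * (1 - lambda)) * (k%:R * t)) =
          4 / lambda * (k%:R * t).
  by field; rewrite !gt_eqF.
by move: ab BE T1; lra.
Qed.

End SquaredNorm.

(** * Counting lattice points and rounding onto them *)

Section Lattice.
Context {R : realType}.

(* Coordinates are encoded by a sign and a magnitude, so 0 occurs twice. *)
Definition lattice_vec n L (z : {ffun 'I_n -> bool * 'I_L}) : 'cV[R]_n :=
  \col_i ((-1) ^+ (z i).1 * (z i).2%:R).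

Lemma lattice_vecE n L (z : {ffun 'I_n -> bool * 'I_L}) i :
  lattice_vec z i 0 ^+ 2 = ((z i).2 ^ 2)%:R.
Proof. by rewrite mxE exprMn sqrr_sign mul1r natrX. Qed.

(** The magnitudes m_i of a counted point satisfy sum m_i <= sum m_i^2 <= 4 n, so 1 <= 16^n prod
    2^(-m_i). Summed over all points, this weight factorises over the coordinates, each contributing
    at most 4: two signs times a geometric sum of at most 2. *)
Lemma lattice_count n L :
  #|[set z : {ffun 'I_n -> bool * 'I_L} |
      sqnorm (lattice_vec z) <= (4 * n)%:R]%SET|%:R <= 64 ^+ n :> R.
Proof.
set A := [set _ | _]%SET.
have half_sum (N : nat) : \sum_(m < N) (2^-1 : R) ^+ m <= 2.
  suff -> : \sum_(m < N) (2^-1 : R) ^+ m = 2 - 2 * 2^-1 ^+ N.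
    by rewrite gerBl mulr_ge0// exprn_ge0// invr_ge0.
  elim: N => [|N IH]; first by rewrite big_ord0 expr0; ring.
  by rewrite big_ord_recr /= IH exprS; field.
rewrite -sum1_card natr_sum.
apply: (@le_trans _ _ (\sum_(z in A) 16 ^+ n * \prod_i 2^-1 ^+ (z i).2)).
  apply: ler_sum => z; rewrite inE sqnorm_cV.
  rewrite (eq_bigr _ (fun i _ => lattice_vecE z i)).
  rewrite -natr_sum ler_nat => zn.
  have {}zn : (\sum_i (z i).2 <= 4 * n)%N.
    by apply: leq_trans zn; apply: leq_sum => i _; case: ((z i).2 : nat) => // m; rewrite leq_pmulr.
  rewrite prodrXr exprVn ler_pdivlMr ?exprn_gt0// mul1r.
  have -> : 16 ^+ n = 2 ^+ (4 * n) :> R by rewrite exprM; congr (_ ^+ _); ring.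
  by rewrite ler_weXn2l// ler1n.
rewrite -mulr_sumr.
have -> : 64 ^+ n = 16 ^+ n * 4 ^+ n :> R by rewrite -exprMn; congr (_ ^+ _); ring.
rewrite ler_wpM2l ?exprn_ge0//.
have p0 (z : {ffun 'I_n -> bool * 'I_L}) : 0 <= \prod_i (2^-1 : R) ^+ (z i).2.
  by apply: prodr_ge0 => i _; rewrite exprn_ge0// invr_ge0.
apply: (@le_trans _ _ (\sum_(z : {ffun 'I_n -> bool * 'I_L}) \prod_i (2^-1 : R) ^+ (z i).2)).
  by rewrite [leRHS](bigID (mem A))/= lerDl sumr_ge0.
rewrite -(bigA_distr_bigA (fun (i : 'I_n) (c : bool * 'I_L) => 2^-1 ^+ c.2)).
rewrite prodr_const card_ord lerXn2r ?nnegrE//.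
  by apply: sumr_ge0 => c _; rewrite exprn_ge0// invr_ge0.
rewrite -(pair_bigA _ (fun (b : bool) (m : 'I_L) => 2^-1 ^+ m))/=.
rewrite big_bool/=; have := half_sum L; lra.
Qed.

Lemma round_toward (r g : R) : exists m : int,
  m%:~R ^+ 2 <= 2 * r ^+ 2 + 2 /\ r * g <= m%:~R * g.
Proof.
have sq (x : R) : `|x - r| <= 1 -> x ^+ 2 <= 2 * r ^+ 2 + 2.
  move=> xr; have : (x - r) ^+ 2 <= 1.
    by rewrite -real_normK ?num_real// expr_le1.
  (* This rests on x^2 = 2 r^2 + 2 (x - r)^2 - (x - 2 r)^2. *)
  by have := sqr_ge0 (x - 2 * r); lra.
have [g0|g0] := leP 0 g.
  exists (Num.ceil r); split; last by rewrite ler_wpM2r// ceil_ge.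
  apply: sq; rewrite ger0_norm ?subr_ge0 ?ceil_ge// lerBlDl.
  by rewrite -lerBlDr; apply: ltW; have := ceilB1_lt r; rewrite ?intrD ?rmorphB.
exists (Num.floor r); split; last by rewrite ler_wnM2r ?ge_floor// ltW.
apply: sq; rewrite ler0_norm ?subr_le0 ?ge_floor// opprB lerBlDl.
by apply: ltW; have := floorD1_gt r; rewrite ?intrD.
Qed.

(* Rounding every coordinate of sqrt n * y in the direction of the sign of g
   can only increase the linear form g. *)
Lemma lattice_round n (y g : 'cV[R]_n) : sqnorm y <= 1 ->
  exists z : {ffun 'I_n -> bool * 'I_(4 * n).+1},
    sqnorm (lattice_vec z) <= (4 * n)%:R /\
    Num.sqrt n%:R * \tr (y *m g^T) <= \tr (lattice_vec z *m g^T).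
Proof.
move=> y1; set q := Num.sqrt n%:R.
have q2 : q ^+ 2 = n%:R by rewrite sqr_sqrtr.
have /fin_all_exists[z zP] (i : 'I_n) : exists c : bool * 'I_(4 * n).+1,
    (c.2 ^ 2)%:R <= 2 * (n%:R * y i 0 ^+ 2) + 2 /\
    q * y i 0 * g i 0 <= (-1) ^+ c.1 * c.2%:R * g i 0.
  have [m [m2 mg]] := round_toward (q * y i 0) (g i 0).
  rewrite exprMn q2 in m2.
  have mE : m%:~R ^+ 2 = (`|m|%N ^ 2)%:R :> R.
    by rewrite natrX natr_absz intr_norm real_normK ?num_real.
  have yi : y i 0 ^+ 2 <= 1.
    apply: le_trans y1; rewrite sqnorm_cV (bigD1 i)//= lerDl.
    by apply: sumr_ge0 => j _; exact: sqr_ge0.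
  have n1 : (1 <= n)%N by apply: leq_ltn_trans (ltn_ord i).
  (* The cap on magnitudes costs nothing: |m| <= m^2 <= 2 n + 2 <= 4 n. *)
  have mL : (`|m|%N < (4 * n).+1)%N.
    rewrite ltnS; apply: (@leq_trans (`|m| ^ 2)).
      by case: `|m|%N => // l; rewrite leq_pmulr.
    rewrite -(ler_nat R) -mE; apply: (le_trans m2).
    rewrite natrM; have : 1 <= n%:R :> R by rewrite ler1n.
    have : n%:R * y i 0 ^+ 2 <= n%:R by rewrite ler_piMr.
    by lra.
  exists (m < 0, Ordinal mL); split; first by rewrite /= -mE.
  apply: (le_trans mg); rewrite {1}[m]intEsign/= rmorphM/= rmorph_sign.
  by rewrite natr_absz.
exists [ffun i => z i]; split.
  rewrite sqnorm_cV; under eq_bigr do rewrite lattice_vecE ffunE.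
  apply: (@le_trans _ _ (\sum_i (2 * (n%:R * y i 0 ^+ 2) + 2))).
    by apply: ler_sum => i _; have [] := zP i.
  rewrite big_split/= -!mulr_sumr -sqnorm_cV sumr_const card_ord.
  rewrite natrM -[2 *+ n]mulr_natr.
  have : n%:R * sqnorm y <= n%:R by rewrite ler_piMr.
  by lra.
rewrite mulr_sumr; apply: ler_sum => i _; rewrite !mxE !big_ord1 !mxE ffunE mulrA.
by have [] := zP i.
Qed.

End Lattice.

(** * Gram matrix and pseudo-inverse of the periodic matrix *)

Section Periodic.
Context {R : realType}.

Lemma sum_modn p tau (F : nat -> R) :
  \sum_(j < p * tau) F (j %% tau)%N = p%:R * \sum_(i < tau) F i.
Proof.
elim: p => [|p IH]; first by rewrite mul0r mul0n big_ord0.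
rewrite -(big_mkord xpredT (fun j => F (j %% tau)%N)) mulSnr.
rewrite (@big_cat_nat _ _ _ (p * tau)) ?leq_addr//= big_mkord IH.
rewrite -[X in \sum_(X <= _ < _) _]add0n big_addn addKn big_mkord -natr1 mulrDl mul1r.
congr (_ + _); apply: eq_bigr => i _.
by rewrite addnC modnMDl modn_small.
Qed.

Lemma periodic_mx_gram p tau :
  periodic_mx tau (p * tau) *m (periodic_mx tau (p * tau))^T = p%:R%:M :> 'M[R]_tau.
Proof.
apply/matrixP => a b; rewrite !mxE.
under eq_bigr do rewrite !mxE.
rewrite (@sum_modn p tau (fun m => (m == a :> nat)%:R * (m == b :> nat)%:R)).
rewrite (bigD1 a)//= eqxx mul1r big1 ?addr0; last first.
  by move=> i ia; rewrite (_ : (i == a :> nat) = false) ?mul0r//; exact/negbTE.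
by rewrite mulr_natr.
Qed.

Section Pseudo.
Variables (p tau : nat) (p0 : (0 < p)%N).
Let L : 'M[R]_(tau, p * tau) := periodic_mx tau (p * tau).

Let pR0 : p%:R != 0 :> R. Proof. by rewrite pnatr_eq0 -lt0n. Qed.

Lemma pseudo_inverse_periodic : pseudo_inverse L = p%:R^-1 *: L^T.
Proof.
by rewrite /pseudo_inverse periodic_mx_gram invmx_scalar mul_mx_scalar.
Qed.

Lemma periodic_pseudo_inverse : L *m pseudo_inverse L = 1%:M.
Proof.
rewrite pseudo_inverse_periodic -scalemxAr periodic_mx_gram scale_scalar_mx.
by rewrite mulVf.
Qed.

Lemma sqnorm_mul_periodic m (A : 'M[R]_(m, tau)) :
  sqnorm (A *m L) = p%:R * sqnorm A.
Proof.
rewrite /sqnorm trmx_mul mulmxA -(mulmxA A) periodic_mx_gram mul_mx_scalar.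
by rewrite -scalemxAl mxtraceZ.
Qed.

(** Here L^+ = L^T / p and |L^T y|^2 = p |y|^2. The factor 1 / p is the gain from averaging over the
    periods. *)
Lemma sqnorm_pseudo_inverse_mul (y : 'cV[R]_tau) :
  sqnorm (pseudo_inverse L *m y) = sqnorm y / p%:R.
Proof.
rewrite pseudo_inverse_periodic -scalemxAl sqnormZ -sqnormT trmx_mul trmxK.
by rewrite sqnorm_mul_periodic sqnormT; field.
Qed.

End Pseudo.
End Periodic.

(** * From an integral inequality on events to one on nonnegative functions *)

Section Transfer.
Context {d d' : measure_display} {T : measurableType d} {E : measurableType d'}.
Context {R : realType} (P : probability T R).
Variables (X Y : T -> E) (D : set T) (G : T -> R) (c : R).
Hypothesis mX : measurable_fun [set: T] X.
Hypothesis mY : measurable_fun [set: T] Y.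
Hypothesis mD : measurable D.
Hypothesis mG : measurable_fun [set: T] G.
Hypothesis G0 : forall x, 0 <= G x.
Hypothesis c0 : 0 <= c.
Hypothesis XY : forall B, measurable B ->
  (\int[P]_(x in D `&` X @^-1` B) (G x)%:E <= c%:E * P (Y @^-1` B))%E.

Import HBNNSimple.

Let mpre (Z : T -> E) (mZ : measurable_fun [set: T] Z) B :
  measurable B -> measurable (Z @^-1` B).
Proof. by move=> mB; rewrite -[_ @^-1` _]setTI; exact: mZ. Qed.

(** [XY] is the claim for indicators; a nonnegative simple function is a finite nonnegative
    combination of them, and both sides are linear. *)
Lemma transfer_nnsfun (g : {nnsfun E >-> R}) :
  (\int[P]_(x in D) (g (X x) * G x)%:E <= c%:E * \int[P]_x (g (Y x))%:E)%E.
Proof.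
have mg k : measurable (g @^-1` [set k]) by exact: measurable_sfunP.
have gE (Z : T -> E) x : (g (Z x))%:E =
    (\sum_(k \in range g) (k * \1_(Z @^-1` (g @^-1` [set k])) x)%:E)%E.
  by rewrite fsumEFin// [in LHS]fimfunE.
have -> : (\int[P]_(x in D) (g (X x) * G x)%:E =
   \sum_(k \in range g)
     (k%:E * \int[P]_(x in D `&` X @^-1` (g @^-1` [set k])) (G x)%:E))%E.
  transitivity (\int[P]_(x in D) (\sum_(k \in range g)
     (k * \1_(X @^-1` (g @^-1` [set k])) x * G x)%:E))%E.
    apply: eq_integral => x _; rewrite EFinM gE ge0_mule_fsuml//; last first.
    by move=> k; rewrite lee_fin; exact: nnfun_muleindic_ge0.
  have k0 k x : 0 <= k * \1_(X @^-1` (g @^-1` [set k])) x.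
    by have := nnfun_muleindic_ge0 g k (X x).
  rewrite ge0_integral_fsum//; last 2 first.
  - move=> k; apply/measurable_EFinP; apply: measurable_funM; last exact: measurable_funTS.
    apply: measurable_funM => //; apply: measurable_indic; exact: mpre.
  - by move=> k x _; rewrite lee_fin mulr_ge0.
  apply: eq_fsbigr => k; rewrite inE => -[e _ gek].
  have kge0 : 0 <= k by rewrite -gek.
  rewrite -ge0_integralZl_EFin//; last 3 first.
  - by apply: measurableI => //; exact: mpre.
  - by move=> x _; rewrite lee_fin.
  - by apply/measurable_EFinP; exact: measurable_funTS.
  rewrite integral_mkcondr; apply: eq_integral => x _.
  by rewrite epatch_indic/= -!EFinM; congr EFin; ring.
under [X in (_ * X)%E]eq_integral => x _ do rewrite gE.
rewrite ge0_integral_fsum//; last 2 first.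
- move=> k; apply/measurable_EFinP; apply: measurable_funM => //.
  by apply: measurable_indic; exact: mpre.
- by move=> k x _; have := nnfun_muleindic_ge0 g k (Y x).
rewrite ge0_mule_fsumr; last first.
  by move=> k; apply: integral_ge0 => x _; have := nnfun_muleindic_ge0 g k (Y x).
apply: lee_fsum => // k [e _ gek].
have kge0 : 0 <= k by rewrite -gek.
under eq_integral do rewrite EFinM.
rewrite ge0_integralZl_EFin//; last first.
  by apply/measurable_EFinP; apply: measurable_indic; exact: mpre.
rewrite integral_indic//; last exact: mpre.
by rewrite setIT muleCA lee_wpmul2l ?lee_fin// XY.
Qed.

(** Monotone convergence on the left along simple approximations [g n] of [f]; on the right,
    [g n <= f] suffices. *)
Lemma transfer_nonneg (f : E -> R) :
  measurable_fun [set: E] f -> (forall e, 0 <= f e) ->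
  (\int[P]_(x in D) (f (X x) * G x)%:E <= c%:E * \int[P]_x (f (Y x))%:E)%E.
Proof.
move=> mf f0; have mfE : measurable_fun [set: E] (EFin \o f) by exact/measurable_EFinP.
pose g := nnsfun_approx measurableT mfE.
have gf e : (EFin \o g ^~ e) @ \oo --> (f e)%:E.
  by apply: cvg_nnsfun_approx => // e' _; rewrite lee_fin.
have gnd e m n : (m <= n)%N -> g m e <= g n e.
  by move=> mn; exact/lefP/nd_nnsfun_approx.
have gle n e : g n e <= f e.
  rewrite -lee_fin; have /cvg_lim <- // := gf e.
  apply: lime_ge; first by apply/cvg_ex; exists (f e)%:E; exact: gf.
  by exists n => //= m nm; rewrite lee_fin gnd.
have mgX n : measurable_fun D (fun x => (g n (X x) * G x)%:E).
  apply/measurable_EFinP; apply: measurable_funTS.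
  by apply: measurable_funM => //; apply: measurableT_comp.
have -> : (\int[P]_(x in D) (f (X x) * G x)%:E =
    limn (fun n => \int[P]_(x in D) (g n (X x) * G x)%:E))%E.
  rewrite -monotone_convergence//.
  - apply: eq_integral => x _; apply/esym/cvg_lim => //.
    apply: (@cvg_trans _ ((fun n => (g n (X x))%:E * (G x)%:E)%E @ \oo)) => //.
    by rewrite EFinM; apply: cvgeZr => //; exact: gf.
  - by move=> n x _; rewrite lee_fin mulr_ge0.
  - by move=> x _ m n mn; rewrite lee_fin ler_wpM2r// gnd.
apply: lime_le.
  apply: ereal_nondecreasing_is_cvgn => m n mn; apply: ge0_le_integral => //.
  - by move=> x _; rewrite lee_fin mulr_ge0.
  - by move=> x _; rewrite lee_fin ler_wpM2r// gnd.
apply: nearW => n; apply: (le_trans (transfer_nnsfun _)).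
rewrite lee_wpmul2l ?lee_fin//; apply: ge0_le_integral => //.
- by move=> x _; rewrite lee_fin.
- by apply/measurable_EFinP; apply: measurableT_comp.
- by apply/measurable_EFinP; apply: measurableT_comp.
- by move=> x _; rewrite lee_fin.
Qed.

End Transfer.

(** * Expectation of a product over independent, identically distributed elements *)

Section Independence.
Context {d d' : measure_display} {T : measurableType d} {E : measurableType d'}.
Context {R : realType} (P : probability T R) (I : finType).
Variables (X : I -> T -> E) (Y : T -> E) (f : E -> R) (C : R).
Hypothesis mX : forall i, measurable_fun [set: T] (X i).
Hypothesis mY : measurable_fun [set: T] Y.
Hypothesis indep : mutually_independent P X.
Hypothesis same : forall i, same_distribution P (X i) Y.
Hypothesis mf : measurable_fun [set: E] f.
Hypothesis f0 : forall e, 0 <= f e.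
Hypothesis fC : (\int[P]_x (f (Y x))%:E <= C%:E)%E.

Let C0 : 0 <= C.
Proof. by rewrite -lee_fin; apply: le_trans fC; apply: integral_ge0 => x _; rewrite lee_fin. Qed.

(* The events indexed by K make the induction on s go through. *)
Lemma integral_prod_le_bigcap (s : seq I) (K : {set I}) (B : I -> set E) :
  uniq s -> all (fun i => i \notin K) s -> (forall i, measurable (B i)) ->
  (\int[P]_(x in \bigcap_(i in [set` K]) (X i @^-1` B i)) (\prod_(i <- s) f (X i x))%:E
   <= (C ^+ size s * \prod_(i in K) fine (P (Y @^-1` B i)))%:E)%E.
Proof.
elim: s K B => [|a s IH] K B /=.
  move=> _ _ mB; under eq_integral do rewrite big_nil.
  have mK : measurable (\bigcap_(i in [set` K]) (X i @^-1` B i)).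
    apply: fin_bigcap_measurable => // i _.
    by rewrite -[_ @^-1` _]setTI; exact: mX.
  rewrite expr0 mul1r integral_cst// mul1e -prodEFin.
  (* Independence enters here: with no factor left to integrate, the probability of the intersection
     factorises. *)
  rewrite [leLHS](_ : _ = (\prod_(i in K) P (X i @^-1` B i))%E); last exact: indep.
  rewrite (eq_bigr (fun i => (fine (P (Y @^-1` B i)))%:E))// => i _.
  rewrite fineK ?same//; apply: fin_num_measure.
  by rewrite -[_ @^-1` _]setTI; exact: mY.
move=> /andP[ans us] /andP[aK sK] mB.
set D := \bigcap_(i in _) _.
have mD : measurable D.
  apply: fin_bigcap_measurable => // i _.
  by rewrite -[_ @^-1` _]setTI; exact: mX.
set c := C ^+ size s * \prod_(i in K) fine (P (Y @^-1` B i)).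
have c0 : 0 <= c.
  by rewrite mulr_ge0 ?exprn_ge0//; apply: prodr_ge0 => i _; rewrite fine_ge0.
pose G x := \prod_(i <- s) f (X i x).
have mG : measurable_fun [set: T] G.
  by apply: measurable_prod => i _; exact: measurableT_comp.
have G0 x : 0 <= G x by apply: prodr_ge0.
have H A : measurable A ->
    (\int[P]_(x in D `&` X a @^-1` A) (G x)%:E <= c%:E * P (Y @^-1` A))%E.
  (* The constraint on [X a] is stored as one more indexed event, so the induction hypothesis
     applies to [a |: K] and yields the hypothesis [XY] of the transfer. *)
  move=> mA; pose B' i := if i == a then A else B i.
  have -> : D `&` X a @^-1` A =
      \bigcap_(i in [set` (a |: K)%SET]) (X i @^-1` B' i).
    apply/seteqP; split => x /=.
      move=> [Dx xA] i /=; rewrite !inE /B' => /orP[/eqP->|iK].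
        by rewrite eqxx.
      by rewrite ifN; [exact: Dx|apply: contraNneq aK => <-].
    move=> Hx; split.
      move=> i /= iK; have := Hx i; rewrite /= !inE iK orbT /B' ifN; first exact.
      by apply: contraNneq aK => <-.
    by have := Hx a; rewrite /= !inE eqxx /B' eqxx; exact.
  have saK : all (fun i => i \notin (a |: K)%SET) s.
    apply/allP => i si; rewrite !inE negb_or (allP sK _ si) andbT.
    by apply: contraNneq ans => <-.
  apply: (le_trans (IH _ B' us saK _)).
    by move=> i; rewrite /B'; case: ifP.
  rewrite big_setU1//= /B' eqxx.
  rewrite (eq_bigr (fun i => fine (P (Y @^-1` B i)))); last first.
    by move=> i iK; rewrite ifN//; apply: contraNneq aK => <-.
  rewrite mulrCA EFinM muleC fineK//; apply: fin_num_measure.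
  by rewrite -[_ @^-1` _]setTI; exact: mY.
under eq_integral do rewrite big_cons.
apply: (le_trans (transfer_nonneg (mX a) mY mD mG G0 c0 H mf f0)).
apply: (le_trans (lee_wpmul2l _ fC)); first by rewrite lee_fin.
by rewrite -EFinM lee_fin exprS /c mulrC mulrA.
Qed.

Lemma integral_prod_le :
  (\int[P]_x (\prod_i f (X i x))%:E <= (C ^+ #|I|)%:E)%E.
Proof.
have := @integral_prod_le_bigcap (index_enum I) finset.set0 (fun=> setT).
rewrite big_set0 mulr1 => /(_ (index_enum_uniq _)).
have -> : \bigcap_(i in [set` finset.set0]) (X i @^-1` setT) = setT.
  by apply/seteqP; split => // x _ i /=; rewrite inE.
rewrite cardT enumT; apply => //.
by apply/allP => i _; rewrite inE.
Qed.

End Independence.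

(** * From moment growth to exponential moments of the square *)

Section SubGaussian.
Context {d : measure_display} {T : measurableType d} {R : realType}.
Variable P : probability T R.

(** Take the exponent 2 m in the supremum defining the norm, then raise to the power 2 m. *)
Lemma moment_le (Z : T -> R) (K : R) (m : nat) : 0 <= K ->
  (subgaussian_norm1 P Z <= K%:E)%E ->
  (\int[P]_x (Z x ^+ (2 * m))%:E <= ((K ^+ 2 * (2 * m)%:R) ^+ m)%:E)%E.
Proof.
(* For m = 0 the exponent lies outside the range p >= 1, and the bound is that of a total mass by
   1. *)
move=> K0 ZK; case: m => [|m].
  under eq_integral do rewrite muln0 expr0.
  by rewrite integral_cst// mul1e expr0; exact: probability_le1.
set q : R := (2 * m.+1)%:R; have q0 : 0 < q by rewrite ltr0n.
have q1 : 1 <= q by rewrite ler1n.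
have Nq : ('N[P]_(q%:E) [EFin \o Z] <= (K * Num.sqrt q)%:E)%E.
  have : ((q `^ (- 2^-1))%:E * 'N[P]_(q%:E) [EFin \o Z] <= K%:E)%E.
    by apply: le_trans ZK; apply: ereal_sup_ubound; exists q.
  rewrite powRN powR12_sqrt ?(ltW q0)// lee_pdivrMl ?sqrtr_gt0//.
  by rewrite muleC EFinM.
have -> : (\int[P]_x (Z x ^+ (2 * m.+1))%:E = 'N[P]_(q%:E) [EFin \o Z] `^ q)%E.
  rewrite poweR_Lnorm ?gt_eqF//; apply: eq_integral => x _ /=.
  by rewrite powR_mulrn// -normrX ger0_norm// exprM exprn_ge0// sqr_ge0.
apply: (@le_trans _ _ ((K * Num.sqrt q)%:E `^ q)%E).
  apply: gt0_ler_poweR => //.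
  - by rewrite in_itv/= Lnorm_ge0 leey.
  - by rewrite in_itv/= leey lee_fin mulr_ge0// sqrtr_ge0.
rewrite poweR_EFin powR_mulrn; last by rewrite mulr_ge0// sqrtr_ge0.
by rewrite exprM [(K * _) ^+ 2]exprMn sqr_sqrtr// ltW.
Qed.

(** The term m^m / m! of the series of e^m is at most e^m, and e <= 4. *)
Lemma exprnn_le_fact (m : nat) : m%:R ^+ m <= 4 ^+ m * m`!%:R :> R.
Proof.
case: m => [|m]; first by rewrite !expr0 fact0 mulr1.
rewrite -ler_pdivrMr ?ltr0n ?fact_gt0//.
have e4 : expR 1 <= 4 :> R.
  (* Taking inverses, this is e^(-1/2) >= 1 - 1/2. *)
  have h : expR (2^-1) <= 2 :> R.
    rewrite -[2^-1]opprK expRN invf_ple ?posrE ?expR_gt0//.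
    by apply: le_trans (expR_ge1Dx _); lra.
  have {1}-> : (1 : R) = 2^-1 + 2^-1 by field.
  rewrite expRD; apply: (@le_trans _ _ (2 * 2)); last by lra.
  by rewrite ler_pM// expR_ge0.
apply: (@le_trans _ _ (expR m.+1%:R)).
  have := @expR_ge1Dxn R m.+1%:R m (ler0n _ _); lra.
rewrite -[X in expR X]mulr1.
by rewrite expRM_natl lerXn2r ?nnegrE ?expR_ge0.
Qed.

(** In the expanded exponential, the n-th term a^n E(Z^(2n)) / n! is at most (2 a K^2)^n n^n / n! <=
    (8 a K^2)^n <= 2^(-n), and these sum to 2. *)
Lemma integral_expR_sqr_le (Z : T -> R) (K a : R) :
  measurable_fun [set: T] Z -> 0 <= K -> 0 <= a -> 16 * a * K ^+ 2 <= 1 ->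
  (subgaussian_norm1 P Z <= K%:E)%E ->
  (\int[P]_x (expR (a * Z x ^+ 2))%:E <= 2%:E)%E.
Proof.
move=> mZ K0 a0 aK ZK.
pose u n x : R := exp_coeff (a * Z x ^+ 2) n.
have u0 n x : 0 <= u n x.
  by rewrite /u /exp_coeff /= divr_ge0// exprn_ge0// mulr_ge0// sqr_ge0.
have mu n : measurable_fun [set: T] (u n).
  rewrite /u /exp_coeff /=; apply: measurable_funM => //.
  by apply: measurable_funX; apply: measurable_funM => //; exact: measurable_funX.
have -> : (\int[P]_x (expR (a * Z x ^+ 2))%:E = \int[P]_x (\sum_(n <oo) (u n x)%:E))%E.
  apply: eq_integral => x _; rewrite /expR; apply/esym/cvg_lim => //.
  rewrite (_ : (fun n => _) = EFin \o series (exp_coeff (a * Z x ^+ 2))); last first.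
    by apply/funext => n /=; rewrite sumEFin.
  by apply: cvg_EFin; [exact: nearW|exact: is_cvg_series_exp_coeff].
rewrite integral_nneseries//; last 2 first.
- by move=> n; exact/measurable_EFinP.
- by move=> n x _; rewrite lee_fin.
(* 2^(-n) is written 2 / 2^(n+1), the form in which [cvg_geometric_eseries_half] sums it. *)
apply: (@le_trans _ _ (\sum_(n <oo) ((2 / (2 ^ (n + 1))%:R)%:E : \bar R))%E).
  apply: lee_nneseries => [n _ _|n _].
    by apply: integral_ge0 => x _; rewrite lee_fin.
  rewrite (eq_integral (fun x => ((a ^+ n / n`!%:R)%:E * (Z x ^+ (2 * n))%:E)%E)); last first.
    by move=> x _; rewrite /u /exp_coeff /= exprMn -exprM -EFinM; congr EFin; ring.
  have an0 : 0 <= a ^+ n / n`!%:R by rewrite divr_ge0// exprn_ge0.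
  rewrite ge0_integralZl_EFin//; last 2 first.
  - by move=> x _; rewrite lee_fin exprM exprn_ge0// sqr_ge0.
  - by apply/measurable_EFinP; exact: measurable_funX.
  apply: (le_trans (lee_wpmul2l _ (moment_le n K0 ZK))); first by rewrite lee_fin.
  rewrite -EFinM lee_fin.
  have -> : 2 / (2 ^ (n + 1))%:R = 2^-1 ^+ n :> R.
    by rewrite addn1 natrX exprS exprVn; field; rewrite expf_neq0.
  apply: (@le_trans _ _ ((2 * a * K ^+ 2) ^+ n * (n%:R ^+ n / n`!%:R))).
    by rewrite natrM !exprMn; lra.
  apply: (@le_trans _ _ ((2 * a * K ^+ 2) ^+ n * 4 ^+ n)).
    rewrite ler_wpM2l//; last by rewrite ler_pdivrMr ?ltr0n ?fact_gt0// exprnn_le_fact.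
    by rewrite exprn_ge0// !mulr_ge0// sqr_ge0.
  have aK0 : 0 <= a * K ^+ 2 by rewrite mulr_ge0// sqr_ge0.
  by rewrite -exprMn lerXn2r ?nnegrE//; lra.
rewrite [leLHS](_ : _ = (2 / 2 ^+ 0)%:E); first by rewrite expr0 divr1.
by apply/cvg_lim => //; exact: cvg_geometric_eseries_half.
Qed.

End SubGaussian.

(** * Tail of the operator norm by a union bound *)

Section OperatorNormTail.
Context {disp : measure_display} {Omega : measurableType disp} {R : realType}.
Variable P : probability Omega R.

Lemma measurable_bigsetU (I : Type) (s : seq I) (p : pred I) (B : I -> set Omega) :
  (forall i, measurable (B i)) -> measurable (\big[setU/set0]_(i <- s | p i) B i).
Proof. by move=> mB; apply: big_ind => // A A' mA mA'; exact: measurableU. Qed.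

Lemma probability_bigsetU_le (I : Type) (s : seq I) (p : pred I) (B : I -> set Omega) :
  (forall i, measurable (B i)) ->
  (P (\big[setU/set0]_(i <- s | p i) B i) <= \sum_(i <- s | p i) P (B i))%E.
Proof.
move=> mB; elim: s => [|i s IH]; first by rewrite !big_nil measure0.
rewrite !big_cons; case: ifP => // _.
apply: (@le_trans _ _ (P (B i) + P (\big[setU/set0]_(j <- s | p j) B j))%E).
  by apply: measureU2 => //; exact: measurable_bigsetU.
by rewrite leeD2l.
Qed.

(** Chernoff's bound: Markov's inequality for [expR (a * Q)]. *)
Lemma exponential_tail_le (Q : Omega -> R) (a t M : R) :
  measurable_fun [set: Omega] Q -> 0 <= a ->
  (\int[P]_w (expR (a * Q w))%:E <= M%:E)%E ->
  (P [set w | (t < Q w)%R] <= (M * expR (- (a * t)))%:E)%E.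
Proof.
move=> mQ a0 QM; set A := [set w | _].
have mA : measurable A.
  rewrite -[A]setTI (_ : A = Q @^-1` `]t, +oo[%classic); last first.
    by apply/seteqP; split => w /=; rewrite in_itv/= andbT.
  exact: mQ.
have mE : measurable_fun [set: Omega] (fun w => (expR (a * Q w))%:E).
  by apply/measurable_EFinP; apply: measurableT_comp => //; exact: measurable_funM.
have : ((expR (a * t))%:E * P A <= M%:E)%E.
  apply: le_trans QM.
  rewrite [leLHS](_ : _ = \int[P]_(w in A) (expR (a * t))%:E)%E; last first.
    by rewrite integral_cst.
  apply: (@le_trans _ _ (\int[P]_(w in A) (expR (a * Q w))%:E)%E).
    apply: ge0_le_integral => //.
    - exact: measurable_funTS.
    - by move=> w /= tQ; rewrite lee_fin ler_expR ler_wpM2l// ltW.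
  by apply: ge0_subset_integral => // w _; rewrite lee_fin expR_ge0.
rewrite -lee_pdivlMl ?expR_gt0// => /le_trans; apply.
by rewrite -EFinM lee_fin expRN mulrC.
Qed.

Lemma measurable_sqnorm_mulmx_cV m n (F : Omega -> 'M[R]_(m, n)) (y : 'cV[R]_n) :
  (forall i j, measurable_fun [set: Omega] (fun w => F w i j)) ->
  measurable_fun [set: Omega] (fun w => sqnorm (F w *m y)).
Proof.
move=> mF; under eq_fun do rewrite sqnorm_cV.
apply: measurable_sum => i; apply: measurable_funX.
under eq_fun do rewrite mxE.
by apply: measurable_sum => j; exact: measurable_funM.
Qed.

(** For |y| <= 1 and u = F y, rounding y in the direction F^T u gives |u|^2 <= <v, u>, with v the
    image of a rescaled lattice point. Cauchy-Schwarz then gives |u|^2 <= |v|^2 <= t, so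
    discretising loses no constant. *)
Lemma sqnorm_mulmx_lattice m n (F : 'M[R]_(m, n)) (t : R) : (0 < n)%N ->
  (forall z : {ffun 'I_n -> bool * 'I_(4 * n).+1},
    sqnorm (lattice_vec z : 'cV[R]_n) <= (4 * n)%:R ->
    sqnorm (F *m ((Num.sqrt n%:R)^-1 *: lattice_vec z)) <= t) ->
  forall y : 'cV[R]_n, sqnorm (F *m y) <= t * sqnorm y.
Proof.
move=> n0 Ft.
have q0 : 0 < Num.sqrt n%:R :> R by rewrite sqrtr_gt0 ltr0n.
have unit (y : 'cV[R]_n) : sqnorm y <= 1 -> sqnorm (F *m y) <= t.
  move=> y1; set u := F *m y.
  have [z [z4 zy]] := lattice_round (F^T *m u) y1.
  set v := F *m ((Num.sqrt n%:R)^-1 *: lattice_vec z).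
  have uv : sqnorm u <= \tr (v *m u^T).
    rewrite /v -scalemxAr -scalemxAl mxtraceZ -ler_pdivrMl ?invr_gt0// invrK.
    move: zy; rewrite trmx_mul trmxK ![in X in X -> _]mulmxA.
    rewrite (mxtrace_mulC (y *m u^T)) (mxtrace_mulC (lattice_vec z *m u^T)).
    by rewrite !mulmxA.
  have {}uv : sqnorm u ^+ 2 <= t * sqnorm u.
    apply: (@le_trans _ _ (sqnorm v * sqnorm u)); last first.
      by rewrite ler_wpM2r ?sqnorm_ge0// Ft.
    apply: le_trans (mxtrace_CauchySchwarz v u).
    by rewrite lerXn2r ?nnegrE ?sqnorm_ge0//; apply: le_trans uv; exact: sqnorm_ge0.
  (* For u = 0 the goal is 0 <= t, which holds because [Ft] bounds some squared norm by [t]. *)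
  have [u0|] := eqVneq (sqnorm u) 0.
    by rewrite u0; apply: le_trans (Ft _ z4); exact: sqnorm_ge0.
  move=> u0; have {}u0 : 0 < sqnorm u by rewrite lt_def u0 sqnorm_ge0.
  by move: uv; rewrite expr2 ler_pM2r.
move=> y; have [->|y0] := eqVneq y 0; first by rewrite mulmx0 !sqnorm0 mulr0.
have sy : 0 < sqnorm y by rewrite lt_def sqnorm_eq0 y0 sqnorm_ge0.
have := unit ((Num.sqrt (sqnorm y))^-1 *: y).
rewrite -scalemxAr !sqnormZ exprVn sqr_sqrtr ?(ltW sy)// mulVf ?gt_eqF//.
by move/(_ (lexx _)); rewrite ler_pdivrMl// mulrC.
Qed.

(** Each of at most 64^n points fails with probability at most 2^m e^(-a t), where a t = 6 (m + n +
    s). *)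
Lemma operator_norm_tail m n (F : Omega -> 'M[R]_(m, n)) (a s : R) :
  (0 < n)%N -> 0 < a -> 0 <= s ->
  (forall i j, measurable_fun [set: Omega] (fun w => F w i j)) ->
  (forall y : 'cV[R]_n, sqnorm y <= 4 ->
    (\int[P]_w (expR (a * sqnorm (F w *m y)))%:E <= (2 ^+ m)%:E)%E) ->
  exists2 E : set Omega,
    measurable E /\ ((1 - 2 * expR (- s))%:E < P E)%E &
    forall w, E w -> forall y : 'cV[R]_n,
      sqnorm (F w *m y) <= 6 * (m%:R + n%:R + s) / a * sqnorm y.
Proof.
move=> n0 a0 s0 mF Fa; set t := 6 * _ / a.
pose A := [set z : {ffun 'I_n -> bool * 'I_(4 * n).+1} |
  sqnorm (lattice_vec z : 'cV[R]_n) <= (4 * n)%:R]%SET.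
pose v (z : {ffun 'I_n -> bool * 'I_(4 * n).+1}) : 'cV[R]_n :=
  (Num.sqrt n%:R)^-1 *: lattice_vec z.
pose B z := [set w | t < sqnorm (F w *m v z)].
have mB z : measurable (B z).
  rewrite -[B z]setTI (_ : B z = (fun w => sqnorm (F w *m v z)) @^-1` `]t, +oo[%classic).
    by apply: (measurable_sqnorm_mulmx_cV (v z) mF).
  by apply/seteqP; split => w /=; rewrite in_itv/= andbT.
set bad := \big[setU/set0]_(z in A) B z.
have mbad : measurable bad by exact: measurable_bigsetU.
have Pbad : (P bad <= (expR (- s))%:E)%E.
  apply: (le_trans (probability_bigsetU_le _ _ mB)).
  apply: (@le_trans _ _ (\sum_(z in A) (2 ^+ m * expR (- (a * t)))%:E)%E).
    apply: lee_sum => z; rewrite inE => zA.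
    apply: exponential_tail_le; rewrite ?(ltW a0)//.
      exact: measurable_sqnorm_mulmx_cV.
    (* The radius 4 in the hypothesis is 4 n, the lattice bound, divided by n. *)
    apply: Fa; rewrite sqnormZ exprVn sqr_sqrtr// ler_pdivrMl ?ltr0n//.
    by rewrite mulrC -natrM.
  rewrite sumEFin lee_fin sumr_const -[leLHS]mulr_natr.
  (* This fixes the 6 in [t]: e^6 absorbs the 2 of each row and the 64 of each column. *)
  have e6 : 64 <= expR 6 :> R.
    have e1 : 2 <= expR 1 :> R by apply: le_trans (expR_ge1Dx _); lra.
    have -> : 6 = 6%:R * 1 :> R by rewrite mulr1.
    rewrite expRM_natl; have -> : 64 = 2 ^+ 6 :> R by ring.
    by rewrite lerXn2r ?nnegrE ?expR_ge0.
  have -> : - (a * t) = - (m%:R * 6) + (- (n%:R * 6) + - (6 * s)).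
    by rewrite /t; field; rewrite gt_eqF.
  rewrite !expRD !expRN !expRM_natl.
  have em : 2 ^+ m * (expR 6 ^+ m)^-1 <= 1 :> R.
    rewrite ler_pdivrMr ?exprn_gt0 ?expR_gt0// mul1r lerXn2r ?nnegrE ?expR_ge0//.
    by apply: le_trans e6; lra.
  have en : #|A|%:R * (expR 6 ^+ n)^-1 <= 1 :> R.
    rewrite ler_pdivrMr ?exprn_gt0 ?expR_gt0// mul1r.
    apply: (le_trans (lattice_count n _)).
    by rewrite lerXn2r ?nnegrE ?expR_ge0.
  have es : (expR s ^+ 6)^-1 <= (expR s)^-1.
    rewrite -expRM_natl.
    by rewrite lef_pV2 ?posrE ?expR_gt0// ler_expR; lra.
  set x := _ * (expR 6 ^+ m)^-1 in em; set y := _ * (expR 6 ^+ n)^-1 in en.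
  rewrite [leLHS](_ : _ = x * y * (expR s ^+ 6)^-1); last by rewrite /x /y; ring.
  rewrite -[leRHS]mul1r ler_pM ?invr_ge0 ?exprn_ge0 ?expR_ge0//.
    by rewrite /x /y !mulr_ge0 ?invr_ge0 ?exprn_ge0 ?expR_ge0.
  by rewrite -[leRHS]mulr1 ler_pM// /x /y mulr_ge0 ?invr_ge0 ?exprn_ge0 ?expR_ge0.
exists (~` bad).
  split; first exact: measurableC.
  rewrite [ltRHS](_ : _ = 1 - P bad)%E; last exact: probability_setC.
  have fP : P bad \is a fin_num by exact: fin_num_measure.
  have Pb : fine (P bad) <= expR (- s) by rewrite -lee_fin fineK.
  (* The bad event has probability at most e^(-s); the second e^(-s) makes the inequality strict. *)
  by rewrite -(fineK fP) -EFinB lte_fin; have := expR_gt0 (- s); lra.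
move=> w badw; apply: sqnorm_mulmx_lattice => // z zA.
rewrite leNgt; apply/negP => Bz; apply: badw.
by rewrite /bad (bigD1 z)/= ?inE//; left.
Qed.

End OperatorNormTail.

(** * Marginals of a vector through its whitened version *)

Section Whitening.
Context {disp : measure_display} {Omega : measurableType disp} {R : realType}.
Variable P : probability Omega R.

Lemma subgaussian_norm1_ge0 (Z : Omega -> R) : (0 <= subgaussian_norm1 P Z)%E.
Proof.
apply: (@le_trans _ _ ((1 `^ (- 2^-1))%:E * 'N[P]_(1%:E) [EFin \o Z])%E).
  by apply: mule_ge0; [rewrite lee_fin powR_ge0|exact: Lnorm_ge0].
by apply: ereal_sup_ubound; exists 1 => /=.
Qed.

Lemma sqnorm_delta n (i : 'I_n) : sqnorm (delta_mx i 0 : 'cV[R]_n) = 1.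
Proof.
rewrite sqnorm_cV (bigD1 i)//= mxE !eqxx expr1n big1 ?addr0// => j ji.
by rewrite mxE (negbTE ji) expr0n.
Qed.

Variables (n : nat) (xi : Omega -> 'rV[R]_n.+1).
Let S := second_moment P xi.
Hypothesis iso : isotropic P (whiten P xi).
Hypothesis Su : S \in unitmx.

(* Isotropy excludes the default value 0 of inv_sqrtmx. *)
Lemma inv_sqrtmxP : posdefmx (inv_sqrtmx S) /\ inv_sqrtmx S *m inv_sqrtmx S = invmx S.
Proof.
rewrite /inv_sqrtmx; case: xgetP => [B _ //|no].
have /matrixP/(_ 0 0) := iso.
rewrite /whiten -/S /inv_sqrtmx xgetPN//= !mxE eqxx /=.
under eq_fun do rewrite mulmx0 mxE mulr0.
by rewrite expectation_cst/= => /eqP; rewrite eq_sym oner_eq0.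
Qed.

(** The witness is S^(1/2), the inverse of [inv_sqrtmx S]; it carries marginals of [xi] to marginals
    of the whitened vector. *)
Lemma sqrtmx_exists : exists W : 'M[R]_n.+1,
  [/\ W \in unitmx,
      (forall w (x : 'cV[R]_n.+1), marginal xi x w = marginal (whiten P xi) (W *m x) w) &
      (forall x : 'cV[R]_n.+1, sqnorm (W *m x) = (x^T *m S *m x) 0 0)].
Proof.
have [[BT Bpos] B2] := inv_sqrtmxP; set B := inv_sqrtmx S in BT Bpos B2.
have Bu : B \in unitmx.
  rewrite -row_free_unit -kermx_eq0; apply/eqP/row_matrixP => i; rewrite row0.
  set u := row i _.
  have uB : u *m B = 0 by apply/sub_kermxP; exact: row_sub.
  apply/eqP; rewrite -[_ == _]negbK; apply/negP => u0.
  have := Bpos u^T; rewrite trmx_eq0 trmxK uB mul0mx mxE ltxx.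
  by move=> /(_ u0).
have WW : invmx B *m invmx B = S.
  have : invmx B *m invmx B *m (B *m B) = 1%:M.
    by rewrite -mulmxA mulKmx// mulVmx.
  by rewrite B2 => /(congr1 (mulmx^~ S)); rewrite mulmxKV// mul1mx.
exists (invmx B); split; first by rewrite unitmx_inv.
  by move=> w x; rewrite /marginal /whiten mulmxA -/S -/B mulmxK.
move=> x; rewrite /sqnorm mxtrace_mulC trmx_mul trmx_inv BT.
by rewrite mulmxA -(mulmxA _ (invmx B) (invmx B)) WW /mxtrace big_ord1.
Qed.

(** At x = W^-1 e_0 the quadratic form equals 1, so the bound |S|_op |x|^2 is positive. *)
Lemma opnorm_second_moment_gt0 : 0 < opnorm S.
Proof.
have [W [Wu _ WS]] := sqrtmx_exists.
have := quadratic_form_le_opnorm S (invmx W *m delta_mx 0 0).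
rewrite -WS mulKVmx// sqnorm_delta => /(lt_le_trans ltr01).
set q := sqnorm _; have [->|q0] := eqVneq q 0; first by rewrite mulr0 ltxx.
by rewrite pmulr_lgt0// lt_def q0 sqnorm_ge0.
Qed.

Hypothesis Kfin : (subgaussian_norm P (whiten P xi) < +oo)%E.
Let K := fine (subgaussian_norm P (whiten P xi)).

Let norm1_le x : enorm x = 1 ->
  (subgaussian_norm1 P (marginal (whiten P xi) x) <= K%:E)%E.
Proof.
move=> x1.
have xK : (subgaussian_norm1 P (marginal (whiten P xi) x) <=
           subgaussian_norm P (whiten P xi))%E.
  by apply: ereal_sup_ubound; exists x.
by rewrite fineK// ge0_fin_numE// (le_trans _ xK)// subgaussian_norm1_ge0.
Qed.

Let delta1 : enorm (delta_mx 0 0 : 'cV[R]_n.+1) = 1.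
Proof. by rewrite enormE sqnorm_delta sqrtr1. Qed.

Let K0 : 0 <= K.
Proof.
by rewrite -lee_fin; apply: le_trans (norm1_le delta1); exact: subgaussian_norm1_ge0.
Qed.

(** If K were 0, a coordinate of the whitened vector would have second moment 0, whereas isotropy
    makes it 1. *)
Lemma subgaussian_norm_isotropic_gt0 : 0 < K.
Proof.
rewrite lt_def K0 andbT; apply/negP => /eqP KE.
have := moment_le 1 K0 (norm1_le delta1).
rewrite KE expr0n mul0r expr1 => m0.
have /matrixP/(_ 0 0) := iso; rewrite !mxE eqxx unlock.
rewrite (eq_integral (fun w => (marginal (whiten P xi) (delta_mx 0 0) w ^+ (2 * 1))%:E)); last first.
  by move=> w _; rewrite muln1 expr2 /marginal -colE [col _ _ _ _]mxE.
suff -> : (\int[P]_w (marginal (whiten P xi) (delta_mx 0 0) w ^+ (2 * 1))%:E = 0)%E.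
  by move=> /eqP; rewrite eq_sym oner_eq0.
apply/eqP; rewrite eq_le m0/=; apply: integral_ge0 => w _.
by rewrite lee_fin muln1 sqr_ge0.
Qed.

(** With r = |W x|, the marginal is r times a unit marginal of the whitened vector, so
    [integral_expR_sqr_le] applies with a r^2, where r^2 = x^T S x. *)
Lemma integral_expR_marginal_sqr_le (x : 'cV[R]_n.+1) (a : R) :
  (forall j, measurable_fun [set: Omega] (fun w => xi w 0 j)) ->
  0 <= a -> 16 * a * K ^+ 2 * (x^T *m S *m x) 0 0 <= 1 ->
  (\int[P]_w (expR (a * marginal xi x w ^+ 2))%:E <= 2%:E)%E.
Proof.
move=> mxi a0; have [W [Wu xiW <-]] := sqrtmx_exists => aK.
(* If W x = 0 there is nothing to normalise: the marginal vanishes and the integrand is 1. *)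
have [v0|v0] := eqVneq (W *m x) 0.
  under eq_integral do rewrite xiW v0 /marginal mulmx0 mxE expr0n mulr0 expR0.
  rewrite integral_cst// mul1e; apply: (@le_trans _ _ 1%E).
    exact: probability_le1.
  by rewrite lee_fin ler1n.
set v := W *m x in v0 aK *; set r := Num.sqrt (sqnorm v).
have sv : 0 < sqnorm v by rewrite lt_def sqnorm_eq0 v0 sqnorm_ge0.
have r0 : 0 < r by rewrite sqrtr_gt0.
have r2 : r ^+ 2 = sqnorm v by rewrite sqr_sqrtr ?ltW.
pose u := r^-1 *: v.
have u1 : enorm u = 1.
  by rewrite enormE sqnormZ exprVn r2 mulVf ?gt_eqF// sqrtr1.
have muE w : marginal (whiten P xi) u w = r^-1 * marginal xi x w.
  by rewrite xiW -/v /marginal -scalemxAr mxE.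
rewrite (eq_integral (fun w =>
    (expR (a * r ^+ 2 * marginal (whiten P xi) u w ^+ 2))%:E)); last first.
  by move=> w _; rewrite muE; congr ((expR _)%:E); field; rewrite gt_eqF.
apply: (@integral_expR_sqr_le _ _ _ P _ K) => //.
- rewrite (_ : marginal _ _ = fun w => r^-1 * \sum_j xi w 0 j * x j 0); last first.
    by apply/funext => w; rewrite muE /marginal mxE.
  apply: measurable_funM => //; apply: measurable_sum => j.
  exact: measurable_funM.
- by rewrite mulr_ge0// sqr_ge0.
- by rewrite r2; move: aK; rewrite mulrAC mulrA.
- exact: norm1_le.
Qed.

End Whitening.

(** The squared norm is a sum over rows, so its exponential is a product over independent rows
    distributed as the first; each of the d factors contributes 2. *)
Lemma integral_expR_noise_le {disp : measure_display} {Omega : measurableType disp}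
    {R : realType} (P : probability Omega R) (d T : nat) (d_gt0 : (0 < d)%N)
    (eps : Omega -> 'M[R]_(d, T)) (x : 'cV[R]_T) (a : R) :
  noise_assumption P d_gt0 eps ->
  (\int[P]_w (expR (a * marginal (first_row d_gt0 eps) x w ^+ 2))%:E <= 2%:E)%E ->
  (\int[P]_w (expR (a * sqnorm (eps w *m x)))%:E <= (2 ^+ d)%:E)%E.
Proof.
move=> noise first2.
(* Independence and equality in law concern [row_tuple], so the integrand is expressed on tuples. *)
pose f (t : T.-tuple R) : R := expR (a * (\sum_j tnth t j * x j 0) ^+ 2).
have mrow i : measurable_fun [set: Omega] (row_tuple eps i).
  apply/measurable_fun_tnthP => j.
  rewrite (_ : _ \o _ = fun w => eps w i j); last first.
    by apply/funext => w /=; rewrite tnth_mktuple.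
  exact: (noise_measurable noise).
have mf : measurable_fun [set: T.-tuple R] f.
  apply: measurableT_comp => //; apply: measurable_funM => //.
  apply: measurable_funX; apply: measurable_sum => j.
  by apply: measurable_funM => //; exact: measurable_tnth.
have fE i w : f (row_tuple eps i w) = expR (a * (eps w *m x) i 0 ^+ 2).
  congr (expR (a * _ ^+ 2)); rewrite mxE; apply: eq_bigr => j _.
  by rewrite tnth_mktuple.
have f2 : (\int[P]_w (f (row_tuple eps (Ordinal d_gt0) w))%:E <= 2%:E)%E.
  apply: le_trans first2; rewrite le_eqVlt; apply/orP; left; apply/eqP.
  apply: eq_integral => w _.
  by rewrite fE /marginal /first_row -row_mul [row _ _ _ _]mxE.
have := integral_prod_le mrow (mrow (Ordinal d_gt0)) (noise_independent noise)
  (fun i => noise_identical noise i _) mf (fun t => expR_ge0 _) f2.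
rewrite card_ord; apply: le_trans; rewrite le_eqVlt; apply/orP; left; apply/eqP.
apply: eq_integral => w _; congr EFin.
under eq_bigr do rewrite fE.
by rewrite -expR_sum -mulr_sumr sqnorm_cV.
Qed.

(** * Choice of the constants and assembly *)

Theorem mainTheorem3 (R : realType) :
  exists c : R, 1 < c /\
  forall (disp : measure_display) (Omega : measurableType disp)
    (P : probability Omega R) (d T k p tau : nat) (d_gt0 : (0 < d)%N),
  (2 <= T)%N -> (1 <= k <= T)%N -> (1 <= p)%N -> (1 <= tau)%N ->
  T = (p * tau)%N ->
  forall (U : 'M[R]_(d, k)) (V : 'M[R]_(k, tau)) (eps : Omega -> 'M[R]_(d, T)),
  let Lambda : 'M[R]_(tau, T) := periodic_mx tau T in
  let M : 'M[R]_(d, T) := U *m V *m Lambda in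
  let X := fun w => M + eps w in
  let epst := fun w => eps w *m pseudo_inverse Lambda in
  noise_assumption P d_gt0 eps ->
  (Knorm P d_gt0 epst <= Knorm P d_gt0 eps)%E ->
  forall S : set 'M[R]_(d, tau),
  S !=set0 -> (forall A, S A -> (\rank A <= k)%N) ->
  forall Mhat : Omega -> 'M[R]_(d, tau),
  (forall w,
    argmin S (fun A => frobenius (A - X w *m pseudo_inverse Lambda) ^+ 2)
      (Mhat w)) ->
  forall lambda s : R, 0 < lambda < 1 -> 0 <= s ->
  (* the event contains a measurable set of probability > 1 - 2 e^-s: no
     measurability of the argmin selection Mhat is required *)
  exists2 E : set Omega,
    measurable E /\ ((1 - 2 * expR (- s))%:E < P E)%E &
    forall w, E w ->
      (d * T)%:R^-1 * frobenius (Mhat w *m Lambda - M) ^+ 2 <=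
      (1 + lambda) / (1 - lambda) *
        inf [set (d * T)%:R^-1 * frobenius (A *m Lambda - M) ^+ 2 | A in S] +
      4 * c * Ktilde P d_gt0 eps * opnorm (Sigma P d_gt0 eps) /
        (lambda * (1 - lambda)) *
        (k%:R * (d%:R + tau%:R + s) / (d * T)%:R).
Proof.
(* 384 = 16 * 4 * 6: 16 from integral_expR_sqr_le, 4 from the radius of the
   lattice vectors, 6 from operator_norm_tail. *)
exists 384; split; first by lra.
move=> disp Omega P d T k p tau d_gt0 T2 kT p1 tau1 TE U V eps Lambda M X epst.
move=> noise _ S S0 Srk Mhat Mmin lambda s l01 s0.
(* Both quantities are divided by in the choice of [a]. The whitening lemmas need a length of the
   form [n.+1], hence the case analysis on [T]. *)
have Sigma_K_gt0 : 0 < opnorm (Sigma P d_gt0 eps) /\ 0 < fine (Knorm P d_gt0 eps).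
  clear -noise T2; case: T T2 eps noise => // T _ eps noise.
  have iso := noise_isotropic noise.
  split; first exact: (opnorm_second_moment_gt0 iso (noise_invertible noise)).
  exact: (subgaussian_norm_isotropic_gt0 iso (noise_Knorm noise)).
have [Sg0 K0] := Sigma_K_gt0.
have expo (x : 'cV[R]_T) (a : R) : 0 <= a ->
    16 * a * fine (Knorm P d_gt0 eps) ^+ 2 *
      (opnorm (Sigma P d_gt0 eps) * sqnorm x) <= 1 ->
    (\int[P]_w (expR (a * sqnorm (eps w *m x)))%:E <= (2 ^+ d)%:E)%E.
  clear -noise T2; case: T T2 eps noise x => // T _ eps noise x a0 aK.
  apply: (integral_expR_noise_le noise).
  apply: integral_expR_marginal_sqr_le => //.
  - exact: (noise_isotropic noise).
  - exact: (noise_invertible noise).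
  - exact: (noise_Knorm noise).
  - move=> j; rewrite /first_row; under eq_fun do rewrite mxE.
    exact: (noise_measurable noise).
  - apply: le_trans aK; rewrite ler_wpM2l ?quadratic_form_le_opnorm//.
    by rewrite mulr_ge0 ?sqr_ge0// mulr_ge0.
subst T; set K := fine _ in K0 expo; set sg := opnorm _ in Sg0 expo *.
have pR : 0 < p%:R :> R by rewrite ltr0n.
(* With this [a], the condition of [expo] at Lambda^+ y reads |y|^2 / 4 <= 1. *)
pose a : R := p%:R / (64 * K ^+ 2 * sg).
have den0 : 0 < 64 * K ^+ 2 * sg by rewrite !mulr_gt0// exprn_gt0.
have a0 : 0 < a by rewrite divr_gt0.
have mepst i j : measurable_fun [set: Omega] (fun w => epst w i j).
  under eq_fun do rewrite mxE.
  apply: measurable_sum => l; apply: measurable_funM => //.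
  exact: (noise_measurable noise).
have exp4 (y : 'cV[R]_tau) : sqnorm y <= 4 ->
    (\int[P]_w (expR (a * sqnorm (epst w *m y)))%:E <= (2 ^+ d)%:E)%E.
  move=> y4; rewrite /epst; under eq_integral do rewrite -mulmxA.
  apply: expo; first exact: ltW.
  rewrite sqnorm_pseudo_inverse_mul//.
  rewrite (_ : _ * _ = sqnorm y / 4); first by rewrite ler_pdivrMr// mul1r.
  by rewrite /a; field; rewrite !gt_eqF.
have [E [mE PE] Ebound] := operator_norm_tail tau1 a0 s0 mepst exp4.
exists E => // w Ew.
have LL : Lambda *m pseudo_inverse Lambda = 1%:M by exact: periodic_pseudo_inverse.
have XE : X w *m pseudo_inverse Lambda = U *m V + epst w.
  by rewrite /X mulmxDl -mulmxA LL mulmx1.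
have [SM minM] := Mmin w.
have fro (A : 'M[R]_(d, tau)) :
    frobenius (A *m Lambda - M) ^+ 2 = p%:R * sqnorm (A - U *m V).
  by rewrite frobenius_sqr -mulmxBl sqnorm_mul_periodic.
set t := 6 * _ / a in Ebound.
have t0 : 0 <= t by rewrite divr_ge0 ?(ltW a0)// mulr_ge0// !addr_ge0.
have [l0 l1] := andP l01; have l1' : 0 < 1 - lambda by rewrite subr_gt0.
have dT0 : 0 < (d * (p * tau))%:R :> R by rewrite ltr0n !muln_gt0 d_gt0 p1 tau1.
have c1 : 0 < (1 + lambda) / (1 - lambda) by rewrite divr_gt0// addr_gt0.
set C2 := (X in _ <= _ + X).
(* p t = 384 K^2 |Sigma|_op (d + tau + s) exactly; the inequality comes from K^2 <= max(K^2,
   K^4). *)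
have C2E : (d * (p * tau))%:R^-1 * (p%:R * (4 / (lambda * (1 - lambda)) * (k%:R * t))) <= C2.
  have -> : (d * (p * tau))%:R^-1 * (p%:R * (4 / (lambda * (1 - lambda)) * (k%:R * t))) =
    4 * 384 * K ^+ 2 * sg / (lambda * (1 - lambda)) *
      (k%:R * (d%:R + tau%:R + s) / (d * (p * tau))%:R).
    by rewrite /t /a; field; rewrite !gt_eqF ?ltr0n.
  apply: ler_wpM2r; first by rewrite divr_ge0// mulr_ge0// !addr_ge0.
  apply: ler_wpM2r; first by rewrite invr_ge0 mulr_ge0// ltW.
  apply: ler_wpM2r; first exact: ltW.
  by apply: ler_wpM2l => //; rewrite /Ktilde le_max lexx.
(* Isolating the infimum reduces the claim to each [A] in [S] separately, with one event [E] serving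
   all of them. *)
rewrite -lerBlDr -ler_pdivrMl//; apply: lb_le_inf.
  by have [A SA] := S0; exists ((d * (p * tau))%:R^-1 * frobenius (A *m Lambda - M) ^+ 2), A.
move=> _ [A SA <-]; rewrite ler_pdivrMl// lerBlDr !fro.
apply: le_trans (lerD (lexx _) C2E).
rewrite [leRHS](_ : _ = (d * (p * tau))%:R^-1 * (p%:R *
  ((1 + lambda) / (1 - lambda) * sqnorm (A - U *m V) +
   4 / (lambda * (1 - lambda)) * (k%:R * t)))); last by ring.
rewrite ler_pM2l ?invr_gt0// ler_pM2l//.
apply: (oracle_inequality (E := epst w)) => //.
- exact: Ebound.
- exact: Srk.
- exact: Srk.
- by have := minM A SA; rewrite !frobenius_sqr XE.
Qed.
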